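(* Let $m\ge 1$ be an integer, and let $\lambda\in\mathbb{C}$ and a step $h>0$ be such that $\lambda h\neq m+1$. The method SIO($m+1$) is stable (for this value of $\lambda h\in\mathbb{C}$) if, and only if, $$\frac{1}{|m+1-\lambda h|}\left|\,m+1+\sum_{k=0}^{m-1}\frac{(m-k)(\lambda h)^{k+1}}{(k+1)!}\right|<1.$$
   Context: Stability refers to absolute stability on the linear test problem $y'=\lambda y$, $y(t_0)=y_0$, with $\lambda\in\mathbb{C}$ and $y_0\neq 0$: the method is stable for $\lambda h$ if the numerical solution $(\tilde w_i)_{i\ge0}$ it produces with constant step $h$ satisfies $\tilde w_i\to 0$ as $i\to\infty$. The method SIO($m+1$) (the Spline-Integral Operator method with spline of degree $m$), applied to $y'=f(t,y)$, $y(t_0)=y_0$, at nodes $t_{i+1}=t_i+h$, is the implicit one-step scheme $$\tilde w_0=y_0,\qquad \tilde w_{i+1}=\tilde w_i+\int_{t_i}^{t_i+h} f\bigl(t,S_m(t_i,t,\tilde w_{i+1})\bigr)\,dt .$$ Here $S_m(t_i,t,w)=T_{m-1}(t_i,t)+s_m(t-t_i)^m$, where $T_{m-1}(t_i,\cdot)$ is the Taylor polynomial of degree $m-1$ at $t_i$ of the solution of the differential equation with value $\tilde w_i$ at $t_i$, and $s_m=(w-T_{m-1}(t_i,t_i+h))/h^m$, so that $S_m(t_i,t_i+h,w)=w$. For the test problem, $f(t,y)=\lambda y$ and $$T_{m-1}(t_i,t)=\tilde w_i\sum_{k=0}^{m-1}\frac{\lambda^k(t-t_i)^k}{k!}.$$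 *)

(* Defs.v *)
From Stdlib Require Import Arith Factorial Reals.
From Coquelicot Require Import Coquelicot.
Open Scope R_scope.

(* [u] solves y' = f(t,y) with u(t0) = y0, on some neighbourhood of t0. *)
Definition local_solution (f : R -> C -> C) (t0 : R) (y0 : C) (u : R -> C) : Prop :=
  u t0 = y0 /\
  locally t0 (fun t => @is_derive R_AbsRing C_R_NormedModule u t (f t (u t))).

(* Coquelicot's [Derive_n] is real-valued, hence the componentwise definition. *)
Definition CDerive_n (u : R -> C) (k : nat) (t : R) : C :=
  (Derive_n (fun s => Re (u s)) k t, Derive_n (fun s => Im (u s)) k t).

Definition taylor (u : R -> C) (n : nat) (a t : R) : C :=
  sum_n (fun k => (CDerive_n u k a * RtoC ((t - a) ^ k / INR (fact k)))%C) n.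

(* S_m(a, t, w) for the step [a, a + h], where T = T_{m-1}(a, .). *)
Definition spline (T : R -> C) (m : nat) (a h : R) (w : C) (t : R) : C :=
  (T t + (w - T (a + h)%R) / RtoC (h ^ m) * RtoC ((t - a) ^ m))%C.

(* One step of SIO(m+1) for y' = f(t,y), from the value [w] at time [a] to the
   value [w'] at time [a + h].  It is a relation because the scheme is
   implicit: [w'] occurs in the integrand. *)
Definition SIO_step (f : R -> C -> C) (m : nat) (h a : R) (w w' : C) : Prop :=
  exists u : R -> C,
    local_solution f a w u /\
    @is_RInt C_R_NormedModule
      (fun t => f t (spline (taylor u (m - 1) a) m a h w' t))
      a (a + h) (w' - w)%C.

Definition SIO_sequence (f : R -> C -> C) (m : nat) (t0 : R) (y0 : C) (h : R)
    (w : nat -> C) : Prop :=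
  w 0%nat = y0 /\
  forall i : nat, SIO_step f m h (t0 + INR i * h) (w i) (w (S i)).

Definition test_rhs (lambda : C) : R -> C -> C := fun _ y => (lambda * y)%C.

(* The implicit scheme is required to determine its numerical solution:
   quantifying over all sequences satisfying it would make stability vacuous
   when there is none. *)
Definition SIO_stable (m : nat) (lambda : C) (t0 : R) (y0 : C) (h : R) : Prop :=
  exists w : nat -> C,
    SIO_sequence (test_rhs lambda) m t0 y0 h w /\
    (forall v : nat -> C,
       SIO_sequence (test_rhs lambda) m t0 y0 h v -> forall i : nat, v i = w i) /\
    filterlim w eventually (locally (RtoC 0)).

(* Main.v *)
(* A local solution of y' = lambda y satisfies u^(k) = lambda^k u near the
   initial time, so its Taylor coefficients there do not depend on the choice of
   the solution.  Integrating the spline term by term turns the implicit step into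
   the linear equation (m + 1 - z) w' = N(z) w with z = lambda h, where N(z) comes
   from (m + 1) z^(k+1)/(k+1)! - z^(k+1)/k! = (m - k) z^(k+1)/(k+1)!.  Hence the
   numerical solution is the geometric sequence of ratio N(z) / (m + 1 - z). *)

Require Import Defs.
From Stdlib Require Import Arith Factorial Reals Lra Lia.
From Coquelicot Require Import Coquelicot.
Open Scope R_scope.

(* [field] and [ring] only find the structure on C when the type of the equation
   is literally [C] and not a carrier projection of Coquelicot's hierarchy. *)
Ltac C_equation :=
  lazymatch goal with |- ?x = ?y => change (@eq C x y) end; cbv beta.

(** * Complex-valued functions of a real variable and solutions of the test equation *)

Lemma is_derive_C_components (u : R -> C) (t : R) (l : C) :
  @is_derive R_AbsRing C_R_NormedModule u t l ->
  is_derive (fun s => Re (u s)) t (Re l) /\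
  is_derive (fun s => Im (u s)) t (Im l).
Proof.
  intros H; split.
  - eapply filterdiff_ext_lin.
    + apply (filterdiff_comp' (V := C_R_NormedModule) u (fun c : C => fst c)).
      * exact H.
      * apply filterdiff_linear, (is_linear_fst (U := R_NormedModule) (V := R_NormedModule)).
    + reflexivity.
  - eapply filterdiff_ext_lin.
    + apply (filterdiff_comp' (V := C_R_NormedModule) u (fun c : C => snd c)).
      * exact H.
      * apply filterdiff_linear, (is_linear_snd (U := R_NormedModule) (V := R_NormedModule)).
    + reflexivity.
Qed.

Lemma is_derive_C_pair (f g : R -> R) (t a b : R) :
  is_derive f t a -> is_derive g t b ->
  @is_derive R_AbsRing C_R_NormedModule (fun s => (f s, g s)) t (a, b).
Proof.
  intros Hf Hg.
  (* The pair is written as [f] times 1 plus [g] times [Ci], so that the rule for a real function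
     times a constant vector applies. *)
  apply (is_derive_ext (V := C_R_NormedModule)
    (fun s => plus (scal (f s) (RtoC 1 : C_R_NormedModule)) (scal (g s) (Ci : C_R_NormedModule)))).
  - intros s; apply injective_projections; cbn; ring.
  - replace ((a, b) : C_R_NormedModule) with
      (plus (scal a (RtoC 1 : C_R_NormedModule)) (scal b (Ci : C_R_NormedModule)))
      by (apply injective_projections; cbn; ring).
    apply (is_derive_plus (V := C_R_NormedModule)); apply (is_derive_scal_l (V := C_R_NormedModule));
      assumption.
Qed.

Lemma test_rhs_local_solution_exists (lambda : C) (a : R) (w : C) :
  exists u : R -> C, local_solution (test_rhs lambda) a w u.
Proof.
  destruct lambda as [p q], w as [x y].
  (* Real and imaginary parts of [(x + i y) exp((p + i q)(t - a))]. *)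
  exists (fun t => (exp (p * (t - a)) * (x * cos (q * (t - a)) - y * sin (q * (t - a))),
                    exp (p * (t - a)) * (x * sin (q * (t - a)) + y * cos (q * (t - a))))).
  split.
  - replace (a - a) with 0 by ring.
    rewrite !Rmult_0_r, exp_0, cos_0, sin_0.
    f_equal; ring.
  - apply filter_forall; intros t.
    unfold test_rhs, Cmult; cbn [fst snd].
    apply is_derive_C_pair; auto_derive; auto; unfold Rminus; ring.
Qed.

Lemma CDerive_n_test_solution (lambda : C) (a : R) (w : C) (u : R -> C) (k : nat) :
  local_solution (test_rhs lambda) a w u ->
  CDerive_n u k a = (lambda ^ k * w)%C.
Proof.
  intros [Hw Hu].
  (* The induction needs the identity on a neighbourhood: a derivative at a point depends on the
     values nearby. *)
  enough (H : locally a (fun t => CDerive_n u k t = (lambda ^ k * u t)%C)).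
  { rewrite <- Hw. exact (locally_singleton _ _ H). }
  induction k as [|k IH].
  - apply filter_forall; intros t. unfold CDerive_n; cbn [Derive_n].
    apply injective_projections; cbn; unfold Re, Im; ring.
  (* At each [t] close to [a] the induction hypothesis then holds around [t], which is what
     [Derive_ext_loc] asks for. *)
  - apply locally_locally in IH.
    generalize (filter_and _ _ IH Hu). apply filter_imp.
    intros t [Ht Hd].
    apply is_derive_C_components in Hd as [Hre Him].
    unfold test_rhs in Hre, Him.
    rewrite Cpow_S; unfold CDerive_n; cbn [Derive_n].
    set (c := (lambda ^ k)%C) in *.
    apply injective_projections; cbn [fst snd].
    + rewrite (Derive_ext_loc _ (fun s => Re c * Re (u s) - Im c * Im (u s))).
      2:{ revert Ht; apply filter_imp; intros s Hs.
          exact (f_equal fst Hs). }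
      apply is_derive_unique.
      replace (fst (lambda * c * u t)%C) with
        (Re c * Re (lambda * u t)%C - Im c * Im (lambda * u t)%C)
        by (unfold Re, Im; cbn; ring).
      apply (is_derive_minus (V := R_NormedModule)); apply is_derive_scal; assumption.
    + rewrite (Derive_ext_loc _ (fun s => Re c * Im (u s) + Im c * Re (u s))).
      2:{ revert Ht; apply filter_imp; intros s Hs.
          exact (f_equal snd Hs). }
      apply is_derive_unique.
      replace (snd (lambda * c * u t)%C) with
        (Re c * Im (lambda * u t)%C + Im c * Re (lambda * u t)%C)
        by (unfold Re, Im; cbn; ring).
      apply (is_derive_plus (V := R_NormedModule)); apply is_derive_scal; assumption.
Qed.

(** * Integrals of polynomials with complex coefficients *)

Lemma is_RInt_shifted_monomial (a h : R) (c : C) (k : nat) :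
  @is_RInt C_R_NormedModule (fun t => (c * RtoC ((t - a) ^ k))%C) a (a + h)
    (c * RtoC (h ^ S k / INR (S k)))%C.
Proof.
  assert (Hk : INR (S k) <> 0) by (apply not_0_INR; lia).
  assert (H : is_RInt (fun t => (t - a) ^ k) a (a + h) (h ^ S k / INR (S k))).
  { evar_last.
    - apply (is_RInt_derive (fun t => (t - a) ^ S k / INR (S k))).
      + intros t _. auto_derive; auto. cbn [pred]; unfold Rminus; field. exact Hk.
      + intros t _. apply (ex_derive_continuous (V := R_NormedModule)). auto_derive; auto.
    - unfold minus, plus, opp; cbn [AbelianGroup.sort AbelianGroup.opp AbelianMonoid.plus]; simpl.
      replace (a + h - a) with h by ring. replace (a - a) with 0 by ring.
      field. exact Hk. }
  apply (is_RInt_ext (V := C_R_NormedModule) (fun t => (fst c * (t - a) ^ k, snd c * (t - a) ^ k))).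
  { intros t _. apply injective_projections; cbn; ring. }
  replace (c * RtoC (h ^ S k / INR (S k)))%C with
    (fst c * (h ^ S k / INR (S k)), snd c * (h ^ S k / INR (S k)))
    by (apply injective_projections; cbn; ring).
  apply (is_RInt_fct_extend_pair (U := R_NormedModule) (V := R_NormedModule));
    apply (is_RInt_scal (V := R_NormedModule)); exact H.
Qed.

Lemma is_RInt_sum_n {V : NormedModule R_AbsRing} (f : nat -> R -> V) (a b : R)
    (l : nat -> V) (n : nat) :
  (forall k, is_RInt (f k) a b (l k)) ->
  is_RInt (fun t => sum_n (fun k => f k t) n) a b (sum_n l n).
Proof.
  intros H; induction n as [|n IH].
  - rewrite sum_O. apply (is_RInt_ext (f 0%nat)); auto.
    intros t _; now rewrite sum_O.
  - rewrite sum_Sn.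
    apply (is_RInt_ext (fun t => plus (sum_n (fun k => f k t) n) (f (S n) t))).
    + intros t _; now rewrite sum_Sn.
    + apply (is_RInt_plus (V := V)); auto.
Qed.

(** * Finite complex sums and the numerator of the amplification factor *)

Lemma sum_n_Cmult_l (c : C) (u : nat -> C) (n : nat) :
  sum_n (fun k => (c * u k)%C) n = (c * sum_n u n)%C.
Proof. exact (sum_n_mult_l c u n). Qed.

Lemma sum_n_C_Sn (u : nat -> C) (n : nat) :
  sum_n u (S n) = (sum_n u n + u (S n))%C.
Proof. exact (sum_Sn u n). Qed.

Lemma sum_n_Cmult_assoc (c : C) (u v : nat -> C) (n : nat) :
  sum_n (fun k => (c * u k * v k)%C) n = (c * sum_n (fun k => (u k * v k)%C) n)%C.
Proof.
  rewrite <- sum_n_Cmult_l. apply sum_n_ext; intros k. apply eq_sym, Cmult_assoc.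
Qed.

(** This is [N(z)], kept in the form that the theorem displays so that it can be folded there. *)
Definition SIO_numerator (m : nat) (z : C) : C :=
  (RtoC (INR (m + 1)) +
   sum_n (fun k => (RtoC (INR (m - k)) * z ^ (k + 1)
                    / RtoC (INR (fact (k + 1))))%C) (m - 1))%C.

Lemma INR_fact_C_neq_0 (k : nat) : RtoC (INR (fact k)) <> RtoC 0.
Proof. intros H; apply (INR_fact_neq_0 k); now apply RtoC_inj. Qed.

Lemma INR_S_C_neq_0 (k : nat) : RtoC (INR (S k)) <> RtoC 0.
Proof. intros H; apply (not_0_INR (S k)); [lia | now apply RtoC_inj]. Qed.

(** The two sums on the right are those that integrating the spline produces. The bound [n < m]
    makes each natural subtraction [m - k] exact. *)
Lemma SIO_numerator_sum (m n : nat) (z : C) :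
  (n < m)%nat ->
  sum_n (fun k => (RtoC (INR (m - k)) * z ^ (k + 1)
                   / RtoC (INR (fact (k + 1))))%C) n =
  (RtoC (INR (S m)) * sum_n (fun k => (z ^ S k / RtoC (INR (fact (S k))))%C) n
   - z * sum_n (fun k => (z ^ k / RtoC (INR (fact k)))%C) n)%C :> C.
Proof.
  assert (Hterm : forall k, (k < m)%nat ->
    (RtoC (INR (m - k)) * z ^ (k + 1) / RtoC (INR (fact (k + 1))) =
     RtoC (INR (S m)) * (z ^ S k / RtoC (INR (fact (S k))))
     - z * (z ^ k / RtoC (INR (fact k))))%C).
  { intros k Hk. replace (k + 1)%nat with (S k) by lia.
    rewrite Cpow_S, fact_simpl, mult_INR, RtoC_mult, minus_INR by lia.
    rewrite (S_INR m).
    (* Writing [m - k] as [(m + 1) - (k + 1)] splits the term in two; in the second, [k + 1] cancels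
       a factor of [(k + 1)!]. *)
    replace (INR m - INR k) with (INR m + 1 - INR (S k)) by (rewrite S_INR; ring).
    rewrite RtoC_minus. field.
    split; [apply INR_fact_C_neq_0 | apply INR_S_C_neq_0]. }
  induction n as [|n IH]; intros Hn.
  - rewrite !sum_O. apply Hterm; exact Hn.
  - rewrite !sum_n_C_Sn, IH, Hterm by lia. ring.
Qed.

Lemma Cminus_neq_0 (x y : C) : x <> y -> (x - y)%C <> RtoC 0.
Proof.
  intros Hxy H; apply Hxy.
  replace x with (x - y + y)%C by ring. rewrite H; ring.
Qed.

(** * The integral of the spline and the solved implicit step *)

Lemma is_RInt_test_spline (lambda : C) (c : nat -> C) (n m : nat) (a h : R) (w : C) :
  h <> 0 ->
  @is_RInt C_R_NormedModule
    (fun t => (lambda * spline (fun t => sum_n (fun k => (c k * RtoC ((t - a) ^ k))%C) n)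
                          m a h w t)%C)
    a (a + h)
    (lambda * (sum_n (fun k => (c k * RtoC (h ^ S k / INR (S k)))%C) n
               + (w - sum_n (fun k => (c k * RtoC (h ^ k))%C) n)
                 * RtoC (h / INR (S m))))%C.
Proof.
  intros Hh.
  set (s := (w - sum_n (fun k => (c k * RtoC (h ^ k))%C) n)%C).
  assert (Hhm : h ^ m <> 0) by now apply pow_nonzero.
  apply (is_RInt_ext (V := C_R_NormedModule)
    (fun t => plus (sum_n (fun k => (lambda * c k * RtoC ((t - a) ^ k))%C : C_R_NormedModule) n)
                   (lambda * (s / RtoC (h ^ m)) * RtoC ((t - a) ^ m))%C)).
  { intros t _. unfold spline. replace (a + h - a) with h by ring. fold s.
    etransitivity; [apply (f_equal2 Cplus); [apply sum_n_Cmult_assoc | reflexivity]|].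
    C_equation.
    ring. }
  replace (lambda * (sum_n (fun k => (c k * RtoC (h ^ S k / INR (S k)))%C) n
               + s * RtoC (h / INR (S m))))%C
    with (plus (sum_n (fun k => (lambda * c k * RtoC (h ^ S k / INR (S k)))%C : C_R_NormedModule) n)
           (lambda * (s / RtoC (h ^ m)) * RtoC (h ^ S m / INR (S m)))%C).
  - apply (is_RInt_plus (V := C_R_NormedModule)).
    + apply (is_RInt_sum_n (V := C_R_NormedModule)
        (fun k t => (lambda * c k * RtoC ((t - a) ^ k))%C)).
      intros k; apply is_RInt_shifted_monomial.
    + apply is_RInt_shifted_monomial.
  - etransitivity; [apply (f_equal2 Cplus); [apply sum_n_Cmult_assoc | reflexivity]|].
    C_equation.
    (* The factor [h ^ m] cancels the normalisation of the leading spline coefficient, leaving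
       [s h / (m + 1)]. *)
    replace (h ^ S m / INR (S m)) with (h ^ m * (h / INR (S m)))
      by (rewrite <- tech_pow_Rmult; unfold Rdiv; ring).
    rewrite RtoC_mult. field.
    intros H; apply Hhm; now apply RtoC_inj.
Qed.

(** The right-hand side no longer mentions [u], and its factors are grouped to match
    [is_RInt_test_spline] with [c k = w * (lambda ^ k / k!)]. *)
Lemma taylor_test_solution (lambda : C) (a : R) (w : C) (u : R -> C) (n : nat) (t : R) :
  local_solution (test_rhs lambda) a w u ->
  taylor u n a t =
  sum_n (fun k => (w * (lambda ^ k / RtoC (INR (fact k))) * RtoC ((t - a) ^ k))%C) n.
Proof.
  intros Hu; apply sum_n_ext; intros k.
  rewrite (CDerive_n_test_solution lambda a w u k Hu).
  unfold Rdiv; rewrite RtoC_mult, RtoC_inv by apply INR_fact_neq_0.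
  C_equation. field. apply INR_fact_C_neq_0.
Qed.

Lemma SIO_step_test_iff (m : nat) (lambda : C) (h a : R) (w w' : C) :
  (1 <= m)%nat -> h <> 0 ->
  (lambda * RtoC h)%C <> RtoC (INR (m + 1)) ->
  SIO_step (test_rhs lambda) m h a w w' <->
  w' = (SIO_numerator m (lambda * RtoC h) / (RtoC (INR (m + 1)) - lambda * RtoC h) * w)%C.
Proof.
  intros Hm Hh Hz.
  set (z := (lambda * RtoC h)%C) in *.
  set (c := fun k => (w * (lambda ^ k / RtoC (INR (fact k))))%C).
  set (I := (lambda * (sum_n (fun k => (c k * RtoC (h ^ S k / INR (S k)))%C) (m - 1)
               + (w' - sum_n (fun k => (c k * RtoC (h ^ k))%C) (m - 1))
                 * RtoC (h / INR (S m))))%C).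
  assert (Hint : forall u, local_solution (test_rhs lambda) a w u ->
    @is_RInt C_R_NormedModule
      (fun t => test_rhs lambda t (spline (taylor u (m - 1) a) m a h w' t))
      a (a + h) I).
  { intros u Hu.
    eapply (is_RInt_ext (V := C_R_NormedModule)).
    2: exact (is_RInt_test_spline lambda c (m - 1) m a h w' Hh).
    intros t _. unfold test_rhs, spline.
    now rewrite !(taylor_test_solution lambda a w u (m - 1) _ Hu). }
  (* Each [lambda] from the equation pairs with an [h] from the integration, so that only [z]
     remains. *)
  assert (HI : I = (w * sum_n (fun k => (z ^ S k / RtoC (INR (fact (S k))))%C) (m - 1)
     + (w' - w * sum_n (fun k => (z ^ k / RtoC (INR (fact k)))%C) (m - 1))
       * (z / RtoC (INR (S m))))%C).
  { unfold I.
    rewrite Cmult_plus_distr_l, <- !sum_n_Cmult_l.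
    f_equal.
    - apply sum_n_ext; intros k. unfold c, z.
      rewrite Cpow_mult_l, Cpow_S, fact_simpl, mult_INR, !RtoC_mult.
      unfold Rdiv; rewrite RtoC_mult, RtoC_inv, <- RtoC_pow by (apply not_0_INR; lia).
      C_equation. field. split; [apply INR_fact_C_neq_0 | apply INR_S_C_neq_0].
    - rewrite (sum_n_ext (fun k => (c k * RtoC (h ^ k))%C)
        (fun k => (w * (z ^ k / RtoC (INR (fact k))))%C)).
      + unfold z, Rdiv; rewrite RtoC_mult, RtoC_inv by (apply not_0_INR; lia).
        field. apply INR_S_C_neq_0.
      + intros k; unfold c, z. rewrite Cpow_mult_l, <- RtoC_pow.
        C_equation. field. apply INR_fact_C_neq_0. }
  assert (Hz' : (RtoC (INR (S m)) - z)%C <> RtoC 0).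
  { apply Cminus_neq_0, not_eq_sym. now replace (S m) with (m + 1)%nat by lia. }
  (* Whatever local solution is chosen, the integral is [I]. Uniqueness of the integral gives one
     direction; the other needs some local solution to exist. *)
  transitivity ((w' - w)%C = I).
  - split.
    + intros (u & Hu & Hw').
      rewrite <- (is_RInt_unique (V := C_R_CompleteNormedModule) _ _ _ _ (Hint u Hu)).
      symmetry. exact (is_RInt_unique (V := C_R_CompleteNormedModule) _ _ _ _ Hw').
    + intros Heq. destruct (test_rhs_local_solution_exists lambda a w) as [u Hu].
      exists u; split; [exact Hu|]. rewrite Heq. exact (Hint u Hu).
  - rewrite HI. unfold SIO_numerator. rewrite SIO_numerator_sum by lia.
    replace (m + 1)%nat with (S m) by lia.
    (* What remains is algebra with [M = m + 1], [A] the sum of [z^k / k!] and [B] that of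
       [z^(k+1) / (k+1)!]. Multiplying by [M] and collecting [w'] gives
       [(M - z) w' = (M + M B - z A) w], and [M - z] is invertible. *)
    generalize (INR_S_C_neq_0 m).
    generalize (sum_n (fun k => (z ^ S k / RtoC (INR (fact (S k))))%C) (m - 1)).
    generalize (sum_n (fun k => (z ^ k / RtoC (INR (fact k)))%C) (m - 1)).
    revert Hz'. generalize (RtoC (INR (S m))). clear. 
    intros M Hz A B HM. split; intros H.
    + assert (HE : ((M - z) * w' = (M + (M * B - z * A)) * w)%C).
      { transitivity (M * (w' - w) + M * w - z * w')%C; [ring|].
        rewrite H. field. exact HM. }
      transitivity (((M - z) * w') / (M - z))%C; [field; exact Hz|].
      rewrite HE. field. exact Hz.
    + rewrite H. field. split; assumption.
Qed.

(** * Convergence of geometric sequences and the stability criterion *)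

Lemma filterlim_C_geom_iff (r y : C) :
  y <> RtoC 0 ->
  filterlim (fun i : nat => (r ^ i * y)%C) eventually (locally (RtoC 0)) <-> Cmod r < 1.
Proof.
  intros Hy.
  assert (Hmod : forall i, Cmod (r ^ i * y)%C = Cmod r ^ i * Cmod y)
    by (intros i; now rewrite Cmod_mult, Cmod_pow).
  assert (Hy' : 0 < Cmod y) by now apply Cmod_gt_0.
  split.
  (* If [|r| >= 1], the moduli [|r|^i |y|] never drop below [|y| > 0], so they cannot tend to 0. *)
  - intros H. apply Rnot_le_lt; intros Hr.
    assert (Hlim : is_lim_seq (fun i => Cmod (r ^ i * y)%C) 0).
    { rewrite <- Cmod_0.
      exact (filterlim_comp _ _ _ _ _ _ _ _ H
        (filterlim_norm (V := C_NormedModule) (RtoC 0))). }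
    assert (Hle : Rbar_le (Cmod y) 0).
    { refine (is_lim_seq_le _ _ _ _ _ (is_lim_seq_const (Cmod y)) Hlim).
      intros i. rewrite Hmod. generalize (pow_R1_Rle _ i Hr). nra. }
    simpl in Hle. lra.
  - intros Hr.
    apply (filterlim_norm_zero (V := C_NormedModule)).
    change (is_lim_seq (fun i => Cmod (r ^ i * y)%C) 0).
    apply (is_lim_seq_ext (fun i => Cmod r ^ i * Cmod y)); [intros i; now rewrite Hmod|].
    replace (Finite 0) with (Rbar_mult 0 (Cmod y)) by (simpl; f_equal; ring).
    apply is_lim_seq_scal_r, is_lim_seq_geom.
    rewrite Rabs_pos_eq; [exact Hr | apply Cmod_ge_0].
Qed.

Theorem proposition4p1 :
  forall (m : nat) (lambda : C) (h t0 : R) (y0 : C),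
    (1 <= m)%nat ->
    0 < h ->
    y0 <> RtoC 0 ->
    (lambda * RtoC h)%C <> RtoC (INR (m + 1)) ->
    (SIO_stable m lambda t0 y0 h <->
     1 / Cmod (RtoC (INR (m + 1)) - lambda * RtoC h)%C *
     Cmod (RtoC (INR (m + 1)) +
           sum_n (fun k => (RtoC (INR (m - k)) * (lambda * RtoC h) ^ (k + 1)
                            / RtoC (INR (fact (k + 1))))%C) (m - 1))%C
     < 1).
Proof.
  intros m lambda h t0 y0 Hm Hh Hy Hz.
  fold (SIO_numerator m (lambda * RtoC h)).
  set (r := (SIO_numerator m (lambda * RtoC h) / (RtoC (INR (m + 1)) - lambda * RtoC h))%C).
  (* This equivalence yields both the existence and the uniqueness demanded by [SIO_stable]. *)
  assert (Hseq : forall v, SIO_sequence (test_rhs lambda) m t0 y0 h v <->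
                           forall i, v i = (r ^ i * y0)%C).
  { assert (Hstep := fun a w w' =>
      SIO_step_test_iff m lambda h a w w' Hm (Rgt_not_eq _ _ Hh) Hz).
    intros v; split.
    - intros [H0 HS] i. induction i as [|i IH].
      + rewrite H0. cbn. ring.
      + specialize (HS i); apply Hstep in HS.
        rewrite HS, IH, Cpow_S. fold r. ring.
    - intros Hv; split.
      + rewrite Hv. cbn. ring.
      + intros i. apply Hstep. rewrite !Hv, Cpow_S. fold r. ring. }
  (* The quantity in the criterion is the modulus of the ratio [r]. *)
  replace (1 / Cmod (RtoC (INR (m + 1)) - lambda * RtoC h)%C
           * Cmod (SIO_numerator m (lambda * RtoC h))) with (Cmod r).
  2:{ assert (HD : (RtoC (INR (m + 1)) - lambda * RtoC h)%C <> RtoC 0).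
      { now apply Cminus_neq_0, not_eq_sym. }
      unfold r. rewrite Cmod_div by exact HD.
      field. now apply Rgt_not_eq, Cmod_gt_0. }
  rewrite <- (filterlim_C_geom_iff r y0 Hy).
  split.
  - intros (w & Hw & _ & Hlim).
    refine (filterlim_ext _ _ _ Hlim). now apply Hseq.
  - intros Hlim. exists (fun i => (r ^ i * y0)%C). split; [|split].
    + now apply Hseq.
    + now intros v Hv; apply Hseq.
    + exact Hlim.
Qed.
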